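(* For each $k\in\{5,6,7\}$, the formal power series \[ F_{k,1}(q)=\sum_{n\ge 0}\frac{\left(q^{2n+2};q^2\right)_\infty\left(q^{2n+2k};q^2\right)_\infty}{\left(q^{2n+1};q^2\right)_\infty^2}\,q^{2n+1} \] has nonnegative coefficients, i.e. writing $F_{k,1}(q)=\sum_{n\ge0}c_{k,1}(n)q^n$, we have $c_{k,1}(n)\ge 0$ for all $n\in\mathbb{N}_0$.
   Context: For $n\in\mathbb{N}_0\cup\{\infty\}$, $(a;q)_n:=\prod_{j=0}^{n-1}(1-aq^j)$. The series $F_{k,1}(q)$ is regarded as a formal power series in $q$ (equivalently, an analytic function for $|q|<1$). *)

(* Defs.v *)
From HB Require Import structures.
From mathcomp Require Import all_boot all_order all_algebra.
From mathcomp Require Import boolp classical_sets.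

Set Implicit Arguments.
Unset Strict Implicit.
Unset Printing Implicit Defensive.

Import Order.TTheory GRing.Theory Num.Theory.
Local Open Scope ring_scope.

Record fps (R : Type) := Fps { fcoef : nat -> R }.

Lemma fpsP (R : Type) (f g : fps R) : fcoef f =1 fcoef g -> f = g.
Proof. by case: f g => [f] [g] /= /funext ->. Qed.

HB.instance Definition _ (R : Type) := gen_eqMixin (fps R).
HB.instance Definition _ (R : Type) := gen_choiceMixin (fps R).

Section FpsRing.
Variable R : comNzRingType.
Implicit Types f g h : fps R.

Definition fps_zero : fps R := Fps (fun _ => 0).
Definition fps_one : fps R := Fps (fun n => (n == 0)%:R).
Definition fps_opp f : fps R := Fps (fun n => - fcoef f n).
Definition fps_add f g : fps R := Fps (fun n => fcoef f n + fcoef g n).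
Definition fps_mul f g : fps R :=
  Fps (fun n => \sum_(i < n.+1) fcoef f i * fcoef g (n - i)).

Fact fps_addA : associative fps_add.
Proof. by move=> f g h; apply: fpsP => n /=; rewrite addrA. Qed.
Fact fps_addC : commutative fps_add.
Proof. by move=> f g; apply: fpsP => n /=; rewrite addrC. Qed.
Fact fps_add0 : left_id fps_zero fps_add.
Proof. by move=> f; apply: fpsP => n /=; rewrite add0r. Qed.
Fact fps_addN : left_inverse fps_zero fps_opp fps_add.
Proof. by move=> f; apply: fpsP => n /=; rewrite addNr. Qed.

HB.instance Definition _ :=
  GRing.isZmodule.Build (fps R) fps_addA fps_addC fps_add0 fps_addN.

Definition fps_trunc (m : nat) f : {poly R} := \poly_(i < m.+1) fcoef f i.

Fact coef_fps_trunc m f n : (n <= m)%N -> (fps_trunc m f)`_n = fcoef f n.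
Proof. by move=> le_nm; rewrite coef_poly ltnS le_nm. Qed.

Fact fcoef_mul_trunc m f g n : (n <= m)%N ->
  fcoef (fps_mul f g) n = (fps_trunc m f * fps_trunc m g)`_n.
Proof.
move=> le_nm; rewrite coefM /=; apply: eq_bigr => i _.
rewrite !coef_fps_trunc //; first exact: leq_trans (leq_subr _ _) le_nm.
by apply: leq_trans le_nm; rewrite -ltnS.
Qed.

Fact fps_mulA : associative fps_mul.
Proof.
move=> f g h; apply: fpsP => n.
transitivity ((fps_trunc n f * fps_trunc n g * fps_trunc n h)`_n).
  rewrite -mulrA coefM; apply: eq_bigr => i _.
  by rewrite coef_fps_trunc -1?ltnS // (@fcoef_mul_trunc n) ?leq_subr.
rewrite coefM; apply: eq_bigr => i _.
by rewrite (@coef_fps_trunc n h) ?leq_subr // (@fcoef_mul_trunc n) // -ltnS.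
Qed.

Fact fps_mulC : commutative fps_mul.
Proof. by move=> f g; apply: fpsP => n; rewrite !(@fcoef_mul_trunc n) // mulrC. Qed.

Fact fps_mul1 : left_id fps_one fps_mul.
Proof.
move=> f; apply: fpsP => n /=; rewrite big_ord_recl /= mul1r subn0 big1 ?addr0 //.
by move=> i _; rewrite mul0r.
Qed.

Fact fps_mulDl : left_distributive fps_mul fps_add.
Proof.
move=> f g h; apply: fpsP => n /=; rewrite -big_split /=.
by apply: eq_bigr => i _; rewrite mulrDl.
Qed.

Fact fps_one_neq0 : fps_one != 0.
Proof.
apply/eqP => /(congr1 (fun f => fcoef f 0)) /= /eqP.
by rewrite oner_eq0.
Qed.

HB.instance Definition _ := GRing.Zmodule_isComNzRing.Build (fps R)
  fps_mulA fps_mulC fps_mul1 fps_mulDl fps_one_neq0.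

Definition fps_unit : {pred fps R} := fun f => `[< exists g, g * f = 1 >].
Definition fps_inv f : fps R := xget f [set g | g * f = 1].

Fact fps_mulV : {in fps_unit, left_inverse 1 fps_inv *%R}.
Proof. by move=> f /asboolP /(xgetPex f). Qed.

Fact fps_unitPl f g : g * f = 1 -> fps_unit f.
Proof. by move=> gf1; apply/asboolP; exists g. Qed.

Fact fps_inv_out : {in [predC fps_unit], fps_inv =1 id}.
Proof.
move=> f; rewrite inE => /asboolPn nuf.
by rewrite /fps_inv; case: xgetP => // g _ gf1; case: nuf; exists g.
Qed.

HB.instance Definition _ := GRing.ComNzRing_hasMulInverse.Build (fps R)
  fps_mulV fps_unitPl fps_inv_out.

Lemma fcoef0 n : fcoef (0 : fps R) n = 0. Proof. by []. Qed.
Lemma fcoef1 n : fcoef (1 : fps R) n = (n == 0)%:R. Proof. by []. Qed.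
Lemma fcoefN f n : fcoef (- f) n = - fcoef f n. Proof. by []. Qed.
Lemma fcoefD f g n : fcoef (f + g) n = fcoef f n + fcoef g n. Proof. by []. Qed.
Lemma fcoefM f g n :
  fcoef (f * g) n = \sum_(i < n.+1) fcoef f i * fcoef g (n - i).
Proof. by []. Qed.

Definition fps_X : fps R := Fps (fun n => (n == 1)%:R).

Lemma fcoefMX f n : fcoef (f * fps_X) n = if n is m.+1 then fcoef f m else 0.
Proof.
rewrite fcoefM; case: n => [|n]; first by rewrite big_ord1 mulr0.
rewrite big_ord_recr /= subnn mulr0 addr0 big_ord_recr /= subSnn mulr1.
rewrite big1 ?add0r // => i _.
by rewrite subSn ?(ltnW (ltn_ord i)) // eqSS subn_eq0 leqNgt ltn_ord mulr0.
Qed.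

Arguments fcoef : simpl never.

Lemma fcoefMXn f m n :
  fcoef (f * fps_X ^+ m) n = if (n < m)%N then 0 else fcoef f (n - m).
Proof.
elim: m n => [|m IHm] n; first by rewrite mulr1 subn0.
by rewrite exprSr mulrA fcoefMX; case: n.
Qed.

(* Convergence for the X-adic topology. *)
Definition fps_cvg (u : nat -> fps R) f :=
  forall n, exists N, forall M, (N <= M)%N -> fcoef (u M) n = fcoef f n.

(* Equal to 0 when u does not converge. *)
Definition fps_lim (u : nat -> fps R) : fps R := xget 0 [set f | fps_cvg u f].

Lemma fps_cvg_unique u f g : fps_cvg u f -> fps_cvg u g -> f = g.
Proof.
move=> uf ug; apply: fpsP => n.
have [N1 h1] := uf n; have [N2 h2] := ug n.
by rewrite -(h1 (maxn N1 N2)) ?leq_maxl // h2 ?leq_maxr.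
Qed.

Lemma fps_cvg_lim u f : fps_cvg u f -> fps_lim u = f.
Proof.
move=> uf; apply: (@fps_cvg_unique u) => //.
by apply: (@xgetPex _ 0 [set f | fps_cvg u f]); exists f.
Qed.

Lemma fps_lim_cvg u :
  (forall n M, (n < M)%N -> fcoef (u M.+1) n = fcoef (u M) n) ->
  fps_cvg u (fps_lim u).
Proof.
move=> uS; have ucv : fps_cvg u (Fps (fun n => fcoef (u n.+1) n)).
  move=> n; exists n.+1 => M; rewrite [RHS]/fcoef; elim: M => // M IHM.
  by rewrite leq_eqVlt => /predU1P[[<-] //|ltnM]; rewrite uS // IHM.
by rewrite (fps_cvg_lim ucv).
Qed.

Definition qpoch (a q : fps R) (n : nat) : fps R :=
  \prod_(j < n) (1 - a * q ^+ j).

Definition qpoch_inf (a q : fps R) : fps R := fps_lim (qpoch a q).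

Lemma qpochXn_cvg (m d : nat) : (0 < d)%N ->
  fps_cvg (qpoch (fps_X ^+ m) (fps_X ^+ d))
          (qpoch_inf (fps_X ^+ m) (fps_X ^+ d)).
Proof.
move=> d_gt0; apply: fps_lim_cvg => n M ltnM.
rewrite /qpoch big_ord_recr /= mulrBr mulr1 fcoefD fcoefN -exprM -exprD fcoefMXn.
by rewrite (leq_trans ltnM) ?subr0 // (leq_trans (leq_pmull M d_gt0)) ?leq_addl.
Qed.

Lemma fcoefM0 f g : fcoef (f * g) 0 = fcoef f 0 * fcoef g 0.
Proof. by rewrite fcoefM big_ord1. Qed.

Lemma fcoef_qpoch_inf0 (m d : nat) : (0 < m)%N -> (0 < d)%N ->
  fcoef (qpoch_inf (fps_X ^+ m) (fps_X ^+ d)) 0 = 1.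
Proof.
move=> m_gt0 d_gt0; have [N /(_ N (leqnn N)) <-] := @qpochXn_cvg m d d_gt0 0.
rewrite /qpoch; elim: N => [|N IHN]; first by rewrite big_ord0.
rewrite big_ord_recr /= fcoefM0 IHN mul1r fcoefD fcoefN -exprM -exprD.
by rewrite -[fps_X ^+ _]mul1r fcoefMXn addn_gt0 m_gt0 subr0.
Qed.

(* First n.+1 coefficients of the inverse of f, when f has constant term 1. *)
Fixpoint fps_inv_seq f (n : nat) : seq R :=
  if n is m.+1 then
    let s := fps_inv_seq f m in
    rcons s (- \sum_(i < m.+1) s`_i * fcoef f (m.+1 - i))
  else [:: 1].

Lemma fps_unit1 f : fcoef f 0 = 1 -> f \is a GRing.unit.
Proof.
move=> f0; pose g : fps R := Fps (fun n => (fps_inv_seq f n)`_n).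
have sz n : size (fps_inv_seq f n) = n.+1.
  by elim: n => //= n IHn; rewrite size_rcons IHn.
have nthE n i : (i <= n)%N -> (fps_inv_seq f n)`_i = fcoef g i.
  elim: n => [|n IHn]; first by rewrite leqn0 => /eqP ->.
  rewrite leq_eqVlt => /predU1P[-> //|lt_in] /=.
  by rewrite nth_rcons sz lt_in IHn.
suff gf1 : g * f = 1 by apply: (@fps_unitPl f g).
apply: fpsP => -[|n]; first by rewrite fcoefM0 f0 mulr1.
rewrite fcoefM big_ord_recr /= subnn f0 mulr1 [fcoef g n.+1]/fcoef /= nth_rcons sz
  ltnn eqxx.
rewrite -sumrB big1 // => i _.
by rewrite nthE ?subrr // -ltnS.
Qed.

End FpsRing.

Arguments fps_X {R}.
Arguments fcoef : simpl never.

Definition F1_term (k n : nat) : fps int :=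
  let q := fps_X in
  qpoch_inf (q ^+ (2 * n + 2)) (q ^+ 2) * qpoch_inf (q ^+ (2 * n + 2 * k)) (q ^+ 2)
    / qpoch_inf (q ^+ (2 * n + 1)) (q ^+ 2) ^+ 2 * q ^+ (2 * n + 1).

Definition F1 (k : nat) : fps int := fps_lim (fun N => \sum_(n < N) F1_term k n).

(* The inverse and the limit taken in F1 are never default values. *)
Lemma F1_denominator_unit (n : nat) :
  qpoch_inf (fps_X ^+ (2 * n + 1)) (fps_X ^+ 2) ^+ 2 \is a @GRing.unit (fps int).
Proof. by rewrite unitrX // fps_unit1 // fcoef_qpoch_inf0 // addn1. Qed.

Lemma F1_cvg (k : nat) : fps_cvg (fun N => \sum_(n < N) F1_term k n) (F1 k).
Proof.
apply: fps_lim_cvg => n M ltnM.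
rewrite big_ord_recr /= fcoefD fcoefMXn (leq_trans ltnM) ?addr0 //.
by rewrite (leq_trans (leq_pmull M (ltn0Sn 1))) ?leq_addr.
Qed.

(* Main.v *)
(* Creative telescoping in the summation index gives the contiguous relation
     (1 - q^(2k-1))^2 F_(k+1) = (1 - q^(2k-2)) F_k + q^(2k-1)   (k >= 1);
   at k = 1 the term in F_1 drops out, so every F_k with k >= 2 is a rational
   function whose poles are roots of unity.  For k = 5, 6, 7 one chooses k
   exponents, read off from the pole orders of F_k (order k at q = 1), such that
   F_k times the product of the corresponding 1 - q^a is a polynomial P, and P
   has the form (1 - q^a) G + B for one of these a, where G and B have
   nonnegative coefficients.  Dividing by the factors 1 - q^a preserves
   nonnegativity. *)

Require Import Defs.
From mathcomp Require Import all_boot all_order all_algebra.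
From mathcomp Require Import ring.

Set Implicit Arguments.
Unset Strict Implicit.
Unset Printing Implicit Defensive.

Import Order.TTheory GRing.Theory Num.Theory.
Local Open Scope ring_scope.

(** * Limits of power series and of infinite products *)

Section Convergence.
Variable R : comNzRingType.
Implicit Types (u v : nat -> fps R) (f g c : fps R).

(** A coefficient of a product involves all lower coefficients of the factors, so one common
    threshold is needed. *)
Lemma fps_cvg_le u f n : fps_cvg u f ->
  exists N, forall M, (N <= M)%N ->
    forall i, (i <= n)%N -> fcoef (u M) i = fcoef f i.
Proof.
move=> uf; elim: n => [|n [N hN]].
  have [N hN] := uf 0%N; exists N => M leNM i.
  by rewrite leqn0 => /eqP->; apply: hN.
have [N' hN'] := uf n.+1; exists (maxn N N') => M; rewrite geq_max => /andP[hM hM'] i.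
by rewrite leq_eqVlt => /predU1P[->|]; [apply: hN' | apply: hN].
Qed.

Lemma fps_cvg_cst c : fps_cvg (fun=> c) c.
Proof. by move=> n; exists 0%N. Qed.

Lemma fps_cvgD u v f g :
  fps_cvg u f -> fps_cvg v g -> fps_cvg (fun N => u N + v N) (f + g).
Proof.
move=> uf vg n; have [N hN] := uf n; have [N' hN'] := vg n.
exists (maxn N N') => M; rewrite geq_max => /andP[hM hM'].
by rewrite !fcoefD hN ?hN'.
Qed.

Lemma fps_cvgM u v f g :
  fps_cvg u f -> fps_cvg v g -> fps_cvg (fun N => u N * v N) (f * g).
Proof.
move=> /fps_cvg_le uf /fps_cvg_le vg n.
have [N hN] := uf n; have [N' hN'] := vg n.
exists (maxn N N') => M; rewrite geq_max => /andP[hM hM'].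
rewrite !fcoefM; apply: eq_bigr => i _.
by rewrite hN ?hN' ?leq_subr // -ltnS.
Qed.

Lemma fps_cvgV u f : (forall N, u N \is a GRing.unit) -> f \is a GRing.unit ->
  fps_cvg u f -> fps_cvg (fun N => (u N)^-1) f^-1.
Proof.
move=> uU fU /fps_cvg_le uf n; have [N hN] := uf n; exists N => M leNM.
(* The correction term has the factor [f - u M], whose coefficients up to [n] vanish. *)
have -> : (u M)^-1 = f^-1 + (f - u M) * ((u M)^-1 * f^-1).
  by rewrite mulrBl mulVKr // mulrCA divrr // mulr1 addrC subrK.
rewrite fcoefD fcoefM big1 ?addr0 // => i _.
by rewrite fcoefD fcoefN hN ?subrr ?mul0r // -ltnS.
Qed.

Lemma fps_cvg_shift u f : fps_cvg u f -> fps_cvg (fun N => u N.+1) f.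
Proof. by move=> uf n; have [N hN] := uf n; exists N => M /leqW /hN. Qed.

Lemma qpoch_inf_recl (m d : nat) : (0 < d)%N ->
  qpoch_inf (fps_X ^+ m) (fps_X ^+ d) =
  (1 - fps_X ^+ m) * qpoch_inf (fps_X ^+ (m + d)) (fps_X ^+ d) :> fps R.
Proof.
move=> d_gt0; apply: (@fps_cvg_unique _
  (fun N => qpoch (fps_X ^+ m) (fps_X ^+ d) N.+1)).
  exact: fps_cvg_shift (qpochXn_cvg _ m d_gt0).
have -> : (fun N => qpoch (fps_X ^+ m) (fps_X ^+ d) N.+1) =
    fun N => (1 - fps_X ^+ m) * qpoch (fps_X ^+ (m + d)) (fps_X ^+ d) N :> fps R.
  apply: boolp.funext => N; rewrite /qpoch big_ord_recl expr0 mulr1; congr (_ * _).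
  by apply: eq_bigr => i _; rewrite exprD -mulrA -exprS.
exact: fps_cvgM (fps_cvg_cst _) (qpochXn_cvg _ _ d_gt0).
Qed.

(** Every factor of the product is 1 modulo [X^m]. *)
Lemma fcoef_qpoch_inf_lt (m d n : nat) : (0 < d)%N -> (n < m)%N ->
  fcoef (qpoch_inf (fps_X ^+ m) (fps_X ^+ d) : fps R) n = (n == 0%N)%:R.
Proof.
move=> d_gt0 lt_nm.
have [N /(_ N (leqnn N)) <-] := @qpochXn_cvg R m d d_gt0 n.
rewrite /qpoch; elim: N => [|N IHN]; first by rewrite big_ord0.
rewrite big_ord_recr /= mulrBr mulr1 fcoefD fcoefN IHN -exprM -exprD fcoefMXn.
by rewrite (leq_trans lt_nm) ?leq_addr // subr0.
Qed.

Lemma qpoch_inf_cvg1 (d : nat) (a : nat -> nat) : (0 < d)%N ->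
  (forall N, (N <= a N)%N) ->
  fps_cvg (fun N => qpoch_inf (fps_X ^+ a N) (fps_X ^+ d)) (1 : fps R).
Proof.
move=> d_gt0 le_a n; exists n.+1 => M ltnM.
by rewrite fcoef_qpoch_inf_lt // (leq_trans ltnM).
Qed.

End Convergence.

(** * The contiguous relation in [k] *)

Section Contiguous.

Let q : fps int := fps_X.
Let p (m : nat) : fps int := qpoch_inf (q ^+ m) (q ^+ 2).

Let pS m : p m = (1 - q ^+ m) * p m.+2.
Proof. by rewrite /p qpoch_inf_recl // addn2. Qed.

Let p_unit m : (0 < m)%N -> p m \is a GRing.unit.
Proof. by move=> m_gt0; rewrite fps_unit1 // fcoef_qpoch_inf0. Qed.

(* The summand satisfies a first-order relation in [k] up to the discrete
   derivative in [N] of the last term; that term vanishes at [N = 0]. *)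
Lemma sum_F1_term_contiguous j N :
  (1 - q ^+ (2 * j + 1)) ^+ 2 * \sum_(n < N) F1_term j.+2 n =
  (1 - q ^+ (2 * j)) * \sum_(n < N) F1_term j.+1 n +
  q ^+ (2 * j + 1) *
    (p (2 * N) * p (2 * N + 2 * j.+1) * (p (2 * N + 1) ^+ 2)^-1).
Proof.
elim: N => [|N IHN].
  by rewrite !big_ord0 pS expr0 subrr !mul0r !mulr0 addr0.
rewrite !big_ord_recr /= mulrDr IHN mulrDr -!addrA; congr (_ + _).
rewrite /F1_term -/q -!/(p _).
(* All products are reduced to [p (2 * N + 2)], [p (2 * N + 2 * j.+2)] and the inverse square of
   [p (2 * N + 1)]; a polynomial identity remains. *)
have -> : (2 * N.+1 = 2 * N + 2)%N by rewrite mulnS addnC.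
have -> : p (2 * N) = (1 - q ^+ (2 * N)) * p (2 * N + 2) by rewrite pS addn2.
have -> : p (2 * N + 2 * j.+1) =
    (1 - q ^+ (2 * N + 2 * j.+1)) * p (2 * N + 2 * j.+2).
  by rewrite [(2 * j.+2)%N]mulnSr addnA addn2 -pS.
have -> : (2 * N + 2 + 2 * j.+1 = 2 * N + 2 * j.+2)%N.
  by rewrite -addnA -mulnS.
have -> : (p (2 * N + 2 + 1) ^+ 2)^-1 =
    (1 - q ^+ (2 * N + 1)) ^+ 2 * (p (2 * N + 1) ^+ 2)^-1.
  have -> : p (2 * N + 1) = (1 - q ^+ (2 * N + 1)) * p (2 * N + 2 + 1).
    by rewrite addnAC addn2 -pS.
  have U : (1 - q ^+ (2 * N + 1)) ^+ 2 \is a GRing.unit.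
    rewrite unitrX // fps_unit1 // fcoefD fcoefN -[q ^+ _]mul1r fcoefMXn.
    by rewrite addn1 /= subr0.
  have U' : p (2 * N + 2 + 1) ^+ 2 \is a GRing.unit.
    by rewrite unitrX // p_unit // addn1.
  by rewrite exprMn (invrM U U') mulrCA divrr // mulr1.
rewrite mulnS.
set P := p _; set P' := p _; set I := _^-1.
rewrite !exprD expr1; set x := q ^+ (2 * N); set y := q ^+ (2 * j).
ring.
Qed.

(** As [N] grows, the infinite products in the boundary term tend to 1, leaving only its
    prefactor. *)
Lemma F1_contiguous j :
  (1 - q ^+ (2 * j + 1)) ^+ 2 * F1 j.+2 =
  (1 - q ^+ (2 * j)) * F1 j.+1 + q ^+ (2 * j + 1).
Proof.
apply: (@fps_cvg_unique _
  (fun N => (1 - q ^+ (2 * j + 1)) ^+ 2 * \sum_(n < N) F1_term j.+2 n)).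
  exact: fps_cvgM (fps_cvg_cst _) (F1_cvg j.+2).
rewrite (boolp.funext (sum_F1_term_contiguous j)).
apply: fps_cvgD; first exact: fps_cvgM (fps_cvg_cst _) (F1_cvg _).
rewrite -[X in fps_cvg _ X]mulr1; apply: fps_cvgM; first exact: fps_cvg_cst.
have le2 N c : (N <= 2 * N + c)%N by rewrite mul2n -addnn -addnA leq_addr.
have p1 c : fps_cvg (fun N => p (2 * N + c)) 1.
  exact: (@qpoch_inf_cvg1 _ 2 (fun N => 2 * N + c)%N).
have p0 : fps_cvg (fun N => p (2 * N)) 1.
  by apply: (@qpoch_inf_cvg1 _ 2 (fun N => 2 * N)%N) => // N; rewrite -[X in (_ <= X)%N]addn0.
(* The limit 1 is spelled with products and an inverse to match the shape of the boundary term. *)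
rewrite -[1]mulr1 -{1}[1]mulr1; apply: fps_cvgM; first exact: fps_cvgM.
rewrite -invr1 -[X in X^-1]mulr1; apply: fps_cvgV.
- by move=> N; rewrite unitrX // p_unit // addn1.
- by rewrite mulr1 unitr1.
- by apply: fps_cvgM.
Qed.

End Contiguous.

(** * Nonnegativity and division by [1 - X^d] *)

Section Nonnegativity.
Variable R : numDomainType.
Implicit Types f g : fps R.

Definition fps_nneg f := forall n, 0 <= fcoef f n.

Lemma fps_nnegD f g : fps_nneg f -> fps_nneg g -> fps_nneg (f + g).
Proof. by move=> f0 g0 n; rewrite fcoefD addr_ge0. Qed.

(** If [h] is the product, then [f_n = h_n + f_(n-d)], with [f_n = h_n] for [n < d]. *)
Lemma fps_nneg_div d f : (0 < d)%N ->
  fps_nneg ((1 - fps_X ^+ d) * f) -> fps_nneg f.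
Proof.
move=> d_gt0 f0; elim/ltn_ind => n IHn.
have /(_ n) := f0; rewrite mulrBl mul1r mulrC fcoefD fcoefN fcoefMXn.
case: ltnP => [_|le_dn]; first by rewrite subr0.
by rewrite subr_ge0; apply: le_trans; rewrite IHn // ltn_subrL d_gt0 (leq_trans d_gt0).
Qed.

Lemma fps_nneg_div_prod (ds : seq nat) f : all (leq 1) ds ->
  fps_nneg (\prod_(d <- ds) (1 - fps_X ^+ d) * f) -> fps_nneg f.
Proof.
elim: ds => [_|d ds IHds /= /andP[d_gt0 /IHds{}IHds]]; first by rewrite big_nil mul1r.
by rewrite big_cons -mulrA => /(fps_nneg_div d_gt0).
Qed.

End Nonnegativity.

(** * Polynomials as coefficient lists, for evaluation *)

Section Lists.

Definition fps_of_seq (s : seq int) : fps int := Fps (nth 0 s).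

Fixpoint addl (s t : seq int) : seq int :=
  match s, t with
  | x :: s', y :: t' => x + y :: addl s' t'
  | [::], _ => t
  | _, [::] => s
  end.

Definition mulXl (d : nat) (s : seq int) : seq int := nseq d 0 ++ s.

Definition oppl (s : seq int) : seq int := map -%R s.

Definition mulBl (d : nat) (s : seq int) : seq int := addl s (mulXl d (oppl s)).

(* The first [size s] coefficients of s / (1 - X^d). *)
Definition divBl (d : nat) (s : seq int) : seq int :=
  foldl (fun g x => rcons g (x + nth 0 (mulXl d g) (size g))) [::] s.

Lemma fcoef_seq s n : fcoef (fps_of_seq s) n = nth 0 s n.
Proof. by []. Qed.

Lemma fps_of_addl s t : fps_of_seq (addl s t) = fps_of_seq s + fps_of_seq t.
Proof.
apply: fpsP => n; rewrite fcoefD !fcoef_seq.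
elim: s t n => [|x s IHs] [|y t] [|n] //=; by rewrite ?addr0 ?add0r.
Qed.

Lemma fps_of_oppl s : fps_of_seq (oppl s) = - fps_of_seq s.
Proof.
apply: fpsP => n; rewrite fcoefN !fcoef_seq.
by elim: s n => [|x s IHs] [|n] //=; rewrite ?oppr0.
Qed.

Lemma fps_of_mulXl d s : fps_of_seq (mulXl d s) = fps_X ^+ d * fps_of_seq s.
Proof.
apply: fpsP => n; rewrite mulrC fcoefMXn !fcoef_seq nth_cat size_nseq nth_nseq.
by case: ltnP.
Qed.

Lemma fps_of_mulBl d s : fps_of_seq (mulBl d s) = (1 - fps_X ^+ d) * fps_of_seq s.
Proof. by rewrite fps_of_addl fps_of_mulXl fps_of_oppl mulrN mulrBl mul1r. Qed.

Lemma fps_of_foldr_mulBl ds s :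
  fps_of_seq (foldr mulBl s ds) =
  \prod_(d <- ds) (1 - fps_X ^+ d) * fps_of_seq s.
Proof.
elim: ds => [|d ds IHds]; first by rewrite big_nil mul1r.
by rewrite big_cons /= fps_of_mulBl IHds mulrA.
Qed.

(** [divBl] keeps the length while [mulBl d] adds [d], so multiplying a quotient back leaves
    trailing zeros. *)
Lemma fps_of_cat0 s n : fps_of_seq (s ++ nseq n 0) = fps_of_seq s.
Proof.
apply: fpsP => i; rewrite !fcoef_seq nth_cat nth_nseq if_same.
by case: ltnP => // /(nth_default 0).
Qed.

Lemma fps_of_seq_nneg s : all (>= 0) s -> fps_nneg (fps_of_seq s).
Proof.
move=> s0 n; rewrite fcoef_seq.
by have [/(all_nthP 0 s0)|/(nth_default 0)->] := ltnP n (size s).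
Qed.

End Lists.

(** * Rational form of [F1] and certificates *)

(* [F1_num r] and [F1_den r] describe [F1 r.+1], for [r > 0] only. *)
Fixpoint F1_den (r : nat) : seq nat :=
  if r is r'.+1 then [:: 2 * r' + 1, 2 * r' + 1 & F1_den r']%N else [::].

Fixpoint F1_num (r : nat) : seq int :=
  if r is r'.+1 then
    addl (mulBl (2 * r') (F1_num r'))
         (mulXl (2 * r' + 1) (foldr mulBl [:: 1] (F1_den r')))
  else [::].

Lemma fps_of_F1_num r :
  \prod_(d <- F1_den r.+1) (1 - fps_X ^+ d) * F1 r.+2 = fps_of_seq (F1_num r.+1).
Proof.
have seq1 : fps_of_seq [:: 1] = 1.
  by apply: fpsP => n; rewrite fcoef_seq fcoef1; case: n => [|[|n]].
elim: r => [|r IHr]; rewrite 2!big_cons mulrCA -!mulrA mulrA -expr2.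
  (* The factor [1 - q ^+ 0] removes [F1 1]; likewise [mulBl 0] cancels the placeholder
     [F1_num 0]. *)
  rewrite big_nil mul1r F1_contiguous expr0 subrr mul0r add0r.
  by apply: fpsP => -[|[|[|n]]]; rewrite // -[_ ^+ 1]mul1r fcoefMXn.
rewrite mulrCA F1_contiguous.
have -> : F1_num r.+2 = addl (mulBl (2 * r.+1) (F1_num r.+1))
  (mulXl (2 * r.+1 + 1) (foldr mulBl [:: 1] (F1_den r.+1))) by [].
rewrite fps_of_addl fps_of_mulBl fps_of_mulXl fps_of_foldr_mulBl.
by rewrite -IHr seq1 mulr1 mulrDr mulrCA [_ * fps_X ^+ _]mulrC.
Qed.

(* The divisions producing [p] and [g] are not trusted: [p] is multiplied back,
   and the remainder of [p] modulo [g] is tested for nonnegativity. *)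
Definition F1_cert (r a : nat) (e : seq nat) : bool :=
  let s := foldr mulBl (F1_num r) (a :: e) in
  let p := foldr divBl s (F1_den r) in
  let g := divBl a p in
  [&& all (leq 1) (a :: e),
      foldr mulBl p (F1_den r) == s ++ nseq (sumn (F1_den r)) 0,
      all (>= 0) g & all (>= 0) (addl p (oppl (mulBl a g)))].

Lemma unit_prod_1BXn (R : comNzRingType) (ds : seq nat) : all (leq 1) ds ->
  \prod_(d <- ds) (1 - fps_X ^+ d) \is a @GRing.unit (fps R).
Proof.
elim: ds => [|d ds IHds] /=; first by rewrite big_nil unitr1.
case/andP=> d_gt0 /IHds U; rewrite big_cons unitrM U andbT fps_unit1 //.
by rewrite fcoefD fcoefN -[_ ^+ d]mul1r fcoefMXn d_gt0 subr0.
Qed.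

Lemma F1_cert_nneg r a e : F1_cert r.+1 a e -> fps_nneg (F1 r.+2).
Proof.
case/and4P => /andP[a_gt0 e_gt0].
set p := foldr divBl _ _; set g := divBl a p => /eqP ps g0 b0.
have den_gt0 : all (leq 1) (F1_den r.+1).
  by elim: r.+1 => //= r' ->; rewrite addn1.
have {ps} Fp : \prod_(d <- a :: e) (1 - fps_X ^+ d) * F1 r.+2 = fps_of_seq p.
  apply: (mulrI (unit_prod_1BXn int den_gt0)).
  rewrite -fps_of_foldr_mulBl ps fps_of_cat0.
  by rewrite mulrCA fps_of_F1_num -fps_of_foldr_mulBl.
apply: (fps_nneg_div_prod e_gt0).
(* With [E] the product over [e], split [E F = (E F - g) + g]; multiplying the bracket by [1 - X^a]
   gives the remainder [p - (1 - X^a) g]. *)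
rewrite -[_ * _](subrK (fps_of_seq g)); apply: fps_nnegD.
  apply: (fps_nneg_div a_gt0); move: Fp.
  rewrite big_cons -mulrA mulrBr => ->.
  by rewrite -fps_of_mulBl -fps_of_oppl -fps_of_addl; apply: fps_of_seq_nneg.
exact: fps_of_seq_nneg.
Qed.

Theorem theorem1p2 (k : nat) (hk : k \in [:: 5; 6; 7]%N) (n : nat) :
  0 <= fcoef (F1 k) n.
Proof.
move: n; change (fps_nneg (F1 k)).
move: hk; rewrite !inE => /or3P[] /eqP->.
(* The first argument is [k - 3 + 1], that is [k - 2]. Each of the exponents 15, 21, 35 covers roots
   of unity of two prime orders with one factor, which keeps the number of factors at [k]. *)
- by apply: (@F1_cert_nneg 3 21 [:: 3; 5; 7; 15]%N); vm_compute.
- by apply: (@F1_cert_nneg 4 35 [:: 3; 5; 7; 9; 9]%N); vm_compute.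
- by apply: (@F1_cert_nneg 5 35 [:: 3; 9; 9; 11; 11; 35]%N); vm_compute.
Qed.
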